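(* Let $X$ be a Banach space of type $p$, $1<p\le 2$, with type constant $T_p(X)$, let $w=\frac{1-p}{p}$, and set $C(X)=\frac{2^{1/p}}{1-2^{w}}\,T_p(X)$. Let $r,k$ be positive integers and let $Z_1,\dots,Z_r\subset X$ be $r$ pairwise disjoint sets of points with $|Z_i|=k$ for all $i\in[r]$. Let $S=\bigcup_{i=1}^r Z_i$ and $D=\max_{i\in[r]}\operatorname{diam} Z_i$. Then there are a point $q\in X$ and a partition $S_1,\dots,S_k$ of $S$ with $|S_i\cap Z_j|=1$ for every $i\in[k]$ and every $j\in[r]$ such that $$\operatorname{dist}\left(q,\operatorname{conv} S_i\right)\le C(X)\, r^{w} D\quad\text{for every } i\in[k].$$
   Context: For a positive integer $m$, $[m]=\{1,\dots,m\}$. A Banach space $X$ is of type $p$, for some $1<p\le 2$, if there is a constant $T_p(X)<\infty$ such that for every finite sequence of vectors $x_1,\dots,x_n\in X$, $$\int_0^1\Big\|\sum_{j=1}^n R_j(t)x_j\Big\|\,dt\le T_p(X)\Big(\sum_{j=1}^n\|x_j\|^p\Big)^{1/p},$$ where $\{R_j\}_{j\ge1}$ are the Rademacher functions. Thus the left-hand side is the average of $\|\sum_j \varepsilon_j x_j\|$ over all $2^n$ choices of signs $\varepsilon_j=\pm1$. $T_p(X)$ denotes the constant in this definition. Distances and diameters are with respect to the norm of $X$. *)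

(* Defs.v *)
From HB Require Import structures.
From mathcomp Require Import all_boot all_order all_algebra.
From mathcomp Require Import all_classical all_reals all_analysis.

Set Implicit Arguments.
Unset Strict Implicit.
Unset Printing Implicit Defensive.

Import Order.TTheory GRing.Theory Num.Theory.
Import numFieldNormedType.Exports.

Local Open Scope classical_set_scope.
Local Open Scope ring_scope.

Definition rademacher (R : realType) (j : nat) (t : R) : R :=
  Num.sg (sin (2 ^+ j * pi * t)).

(* The Rademacher functions are indexed from 1, hence [i.+1] for [i : 'I_n].
   Any constant satisfying the inequalities is accepted, not only the least. *)
Definition type_constant (R : realType) (X : normedModType R) (p T : R) : Prop :=
  forall (n : nat) (x : 'I_n -> X),
    (\int[lebesgue_measure]_(t in `[0%R, 1%R])
        (`| \sum_(i < n) rademacher i.+1 t *: x i |)%:E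
     <= (T * (\sum_(i < n) `| x i | `^ p) `^ p^-1)%:E)%E.

(* Real-valued [sup]: meaningful for nonempty bounded [A] only. *)
Definition diam (R : realType) (X : normedModType R) (A : set X) : R :=
  sup [set d | exists x y, [/\ A x, A y & d = `| x - y |]].

Definition conv_hull (R : realType) (X : normedModType R) (A : set X) : set X :=
  smallest [set C | convex_set C] A.

(* Main.v *)
(* Choose q to be the centroid of S.  Pair up the points of every Z_j (after
   moving to the second half, when their number is odd, one point of each Z_j, these
   points nearly adding up to the sum of the means) and put the two points of each
   pair into different halves.  Type p, applied to the differences of the pairs,
   gives a choice of signs for which the centroids of the halves differ from the
   old centroid by at most m^w r^w T D, where m is the size of the smaller half.
   Iterating until the parts are transversals, these displacements add up to a
   geometric-like series bounded by 2^(1/p) / (1 - 2^w).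

   The Rademacher integral is only bounded below, by the integral of the step
   function of its values on open dyadic intervals. *)

Require Import Defs.
From mathcomp Require Import all_boot all_order all_algebra.
From mathcomp Require Import all_classical all_reals all_analysis.
From mathcomp Require Import measurable_realfun zify ring lra.
Import Order.TTheory GRing.Theory Num.Theory.
Import numFieldNormedType.Exports.

Set Implicit Arguments.
Unset Strict Implicit.
Unset Printing Implicit Defensive.

Local Open Scope classical_set_scope.
Local Open Scope ring_scope.

(** * Rademacher functions on dyadic intervals *)

(** The integral of a nonnegative function is a supremum over the nonnegative simple functions below
    it, and those below [f] are also below [g]. Here [g] will be the Rademacher integrand. *)
Lemma ge0_le_integral_nonmeasurable d (T : measurableType d) (R : realType)
    (mu : {measure set T -> \bar R}) (D : set T) (f g : T -> \bar R) :
  (forall x, D x -> (0 <= f x)%E) -> (forall x, D x -> (f x <= g x)%E) ->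
  (\int[mu]_(x in D) f x <= \int[mu]_(x in D) g x)%E.
Proof.
move=> f0 fg; have g0 x : D x -> (0 <= g x)%E.
  by move=> Dx; exact: le_trans (f0 x Dx) (fg x Dx).
rewrite !ge0_integralE//; apply: le_ereal_sup => _ [h /= hf <-].
exists h => //= x; apply: le_trans (hf x) _.
rewrite !patchE; case: ifPn => // xD; apply: fg; exact: set_mem.
Qed.

Lemma sg_sin_pi (R : realType) (a : nat) (u : R) :
  a%:R < u -> u < a.+1%:R -> Num.sg (sin (pi * u)) = (-1) ^+ a.
Proof.
elim: a u => [|a ih] u au ua; have pi0 : (0 : R) < pi by exact: pi_gt0.
  rewrite expr0 gtr0_sg// sin_gt0_pi// mulr_gt0//=.
  by rewrite -[ltRHS]mulr1 ltr_pM2l.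
have -> : pi * u = pi * (u - 1) + pi by rewrite mulrBr mulr1 subrK.
by rewrite sinDpi sgrN ih ?exprS ?mulN1r// ?ltrBrDr ?ltrBlDr ?natr1.
Qed.

(** Open, since at an endpoint some of the first [n] Rademacher functions may vanish. *)
Definition dyadic (R : realType) (n s : nat) : set R :=
  `]s%:R / 2 ^+ n, s.+1%:R / 2 ^+ n[.

Arguments dyadic : clear implicits.

(** The exponent has the parity of the [i]-th binary digit of [s], counted from the most significant
    of [n] digits. *)
Definition dyadic_sign (R : realType) (n s i : nat) : R :=
  (-1) ^+ (s %/ 2 ^ (n - i.+1)).

Lemma dyadic_signE (R : realType) (n s i : nat) (t : R) : (i < n)%N ->
  dyadic R n s t -> rademacher i.+1 t = dyadic_sign R n s i.
Proof.
move=> ilt; rewrite /dyadic /= in_itv /= => /andP[lo hi].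
have -> : rademacher i.+1 t = Num.sg (sin (pi * (2 ^+ i.+1 * t))) :> R.
  by rewrite /rademacher mulrCA mulrA.
set d := (2 ^ (n - i.+1))%N.
have d0 : (0 < d)%N by rewrite expn_gt0.
have e : (2 ^+ n = d%:R * 2 ^+ i.+1 :> R).
  by rewrite /d natrX -exprD subnK.
have dR : (0 : R) < d%:R by rewrite ltr0n.
have qR : (0 : R) < 2 ^+ i.+1 by rewrite exprn_gt0.
rewrite e ltr_pdivrMr ?mulr_gt0// in lo.
rewrite e ltr_pdivlMr ?mulr_gt0// in hi.
(* With [a = s %/ d], the point [2 ^+ i.+1 * t] lies strictly between [a] and [a + 1]: after
   multiplication by [d], this follows from [a * d <= s] and [s.+1 <= a.+1 * d]. *)
apply: sg_sin_pi.
  rewrite -(ltr_pM2r dR) -natrM (le_lt_trans (y := s%:R))//.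
    by rewrite ler_nat leq_divM.
  by rewrite (lt_le_trans lo)// mulrAC mulrC [d%:R * _]mulrC.
rewrite -(ltr_pM2r dR) -natrM (lt_le_trans (y := s.+1%:R))//.
  by rewrite (le_lt_trans _ hi)// mulrAC mulrC [d%:R * _]mulrC.
by rewrite ler_nat ltn_ceil.
Qed.

Lemma dyadic_inj (R : realType) (n s s' : nat) (t : R) :
  dyadic R n s t -> dyadic R n s' t -> s = s'.
Proof.
rewrite /dyadic /= !in_itv /= => /andP[a b] /andP[a' b'].
have i0 : (0 : R) < (2 ^+ n)^-1 by rewrite invr_gt0 exprn_gt0.
apply/eqP; rewrite eqn_leq -[(s <= s')%N]ltnS -[(s' <= s)%N]ltnS -!(ltr_nat R).
by rewrite -(ltr_pM2r i0) (lt_trans a b')// -(ltr_pM2r i0) (lt_trans a' b).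
Qed.

Lemma lebesgue_measure_dyadic (R : realType) (n : nat) (s : 'I_(2 ^ n)) :
  lebesgue_measure (dyadic R n s `&` `[0%R, 1%R]) = ((2 ^+ n)^-1)%:E.
Proof.
have p0 : (0 : R) < 2 ^+ n by rewrite exprn_gt0.
have -> : dyadic R n s `&` `[0%R, 1%R] = dyadic R n s.
  apply/setIidPl => t; rewrite /dyadic /= !in_itv /= => /andP[lo hi].
  apply/andP; split; first by apply: le_trans (ltW lo); rewrite divr_ge0// ltW.
  rewrite (le_trans (ltW hi))// ler_pdivrMr// mul1r -natrX ler_nat.
  exact: ltn_ord.
rewrite lebesgue_measure_itv /= lte_fin ltr_pM2r ?invr_gt0// ltr_nat ltnSn.
by rewrite -EFinB -mulrBl -natr1 addrAC subrr add0r mul1r.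
Qed.

(** The step function [g] below takes the value [c s] on the [s]-th dyadic interval and 0 at the
    remaining points. It lies below the Rademacher integrand, and its integral is the average of the
    [c s]. *)
Lemma type_constant_dyadic (R : realType) (X : normedModType R) (p T : R)
    (n : nat) (x : 'I_n -> X) : type_constant X p T ->
  \sum_(s < 2 ^ n) `| \sum_(i < n) dyadic_sign R n s i *: x i |
  <= (2 ^ n)%:R * (T * (\sum_(i < n) `| x i | `^ p) `^ p^-1).
Proof.
move=> /(_ n x); set f := (f in (\int[_]_(t in _) f t <= _)%E) => hT.
pose c s := `| \sum_(i < n) dyadic_sign R n s i *: x i |.
pose g (t : R) := (\sum_(s < 2 ^ n) (c s)%:E * (\1_(dyadic R n s) t)%:E)%E.
have g0 s (t : R) : (0 <= (c s)%:E * (\1_(dyadic R n s) t)%:E)%E.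
  by rewrite mule_ge0 ?lee_fin// /c normr_ge0.
have gf t : (g t <= f t)%E.
  have [[s st]|no] := pselect (exists s : 'I_(2 ^ n), dyadic R n s t).
    rewrite /g (bigD1 s)//= big1 ?adde0 => [|s' s's]; last first.
      rewrite indicE memNset ?mule0// => s't; move/eqP: s's; apply.
      by apply: val_inj; exact: dyadic_inj s't st.
    rewrite indicE mem_set// mule1 /f lee_fin /c.
    by under [in leRHS]eq_bigr => i _ do rewrite (dyadic_signE _ st)//.
  rewrite /g big1 => [|s _]; first by rewrite /f lee_fin.
  by rewrite indicE memNset ?mule0// => st; apply: no; exists s.
have : (\int[lebesgue_measure]_(t in `[0%R, 1%R]) g t
    <= (T * (\sum_(i < n) `|x i| `^ p) `^ p^-1)%:E)%E.
  apply: le_trans hT; apply: ge0_le_integral_nonmeasurable => // t _.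
  by apply: sume_ge0 => s _.
have md s : measurable (dyadic R n s) by exact: measurable_itv.
have mI s : measurable_fun (`[0%R, 1%R] : set (measurableTypeR R))
    (EFin \o (\1_(dyadic R n s) : R -> R)).
  by apply/measurable_EFinP; apply: measurable_indic; exact: md.
rewrite ge0_integral_sum//; last by move=> s; apply: measurable_funeM; exact: mI.
have intE (s : 'I_(2 ^ n)) : (\int[lebesgue_measure]_(t in `[0%R, 1%R])
    ((c s)%:E * (\1_(dyadic R n s) t)%:E) = (c s / 2 ^+ n)%:E)%E.
  rewrite ge0_integralZl_EFin//; [|exact: mI|exact: normr_ge0].
  rewrite integral_indic//; last exact: md.
  rewrite EFinM; congr (_ * _)%E.
  exact: lebesgue_measure_dyadic.
under eq_bigr => s _ do rewrite intE.
rewrite sumEFin lee_fin -mulr_suml ler_pdivrMr ?exprn_gt0//.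
by rewrite natrX mulrC.
Qed.

(** * Choosing signs by averaging *)

Lemma exists_le_average (R : realType) (I : finType) (F : I -> R) (B : R) :
  (0 < #|I|)%N -> \sum_i F i <= #|I|%:R * B -> exists i, F i <= B.
Proof.
move=> /card_gt0P[i0 _]; apply: contraPP => /forallNP nF.
apply/negP; rewrite -ltNge -sum1_card natr_sum mulr_suml.
under eq_bigr do rewrite mul1r.
apply: ltr_sum => [|i _]; first by apply/hasP; exists i0; rewrite ?mem_index_enum.
by rewrite ltNge; apply/negP/nF.
Qed.

(** The signs [e] are fixed before the vectors, so that one family of sign patterns serves many
    families of vectors at once in [near_mean_choice]. *)
Lemma type_average (R : realType) (X : normedModType R) (p T : R) (I : finType) :
  0 < p -> 0 <= T -> type_constant X p T ->
  exists2 N, (0 < N)%N & exists e : 'I_N -> I -> bool,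
    forall (x : I -> X) D, 0 <= D -> (forall i, `|x i| <= D) ->
      \sum_(s < N) `| \sum_i (-1) ^+ e s i *: x i |
      <= N%:R * (T * #|I|%:R `^ p^-1 * D).
Proof.
move=> p0 T0 hT; exists (2 ^ #|I|)%N; first by rewrite expn_gt0.
exists (fun s i => odd (s %/ 2 ^ (#|I| - (enum_rank i).+1))) => x D D0 xD.
have h := type_constant_dyadic (fun i : 'I_#|I| => x (enum_val i)) hT.
under eq_bigr => s _.
  rewrite (_ : \sum_i _ =
    \sum_(i < #|I|) dyadic_sign R #|I| s i *: x (enum_val i)); last first.
    rewrite (reindex_onto enum_val enum_rank) => [|i _]; last by rewrite enum_rankK.
    apply: eq_big => [i|i _]; first by rewrite enum_valK eqxx.
    by rewrite enum_valK signr_odd.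
  over.
apply: le_trans h _; rewrite ler_wpM2l// -mulrA ler_wpM2l//.
apply: (@le_trans _ _ ((#|I|%:R * D `^ p) `^ p^-1)).
  apply: ge0_ler_powR; rewrite ?invr_ge0 ?(ltW p0)// ?nnegrE.
  - by apply: sumr_ge0 => i _; exact: powR_ge0.
  - by rewrite mulr_ge0// powR_ge0.
  - rewrite mulr_natl -[X in _ *+ X]card_ord -sumr_const.
    by apply: ler_sum => i _; rewrite ge0_ler_powR ?nnegrE ?(ltW p0).
by rewrite powRM ?powR_ge0// -powRrM divff ?gt_eqF// powRr1.
Qed.

Lemma type_sign (R : realType) (X : normedModType R) (p T : R) (I : finType)
    (x : I -> X) D : 0 < p -> 0 <= T -> type_constant X p T ->
  0 <= D -> (forall i, `|x i| <= D) ->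
  exists e : I -> bool,
    `| \sum_i (-1) ^+ e i *: x i | <= T * #|I|%:R `^ p^-1 * D.
Proof.
move=> p0 T0 hT D0 xD; have [N N0 [e he]] := type_average I p0 T0 hT.
have := he x D D0 xD; rewrite -[X in X%:R * _](card_ord N).
by case/exists_le_average => [|s hs]; [rewrite card_ord|exists (e s)].
Qed.

(** * Halving all the sets at once *)

Lemma perm_swap_pairs (X : choiceType) (I : Type) (s : seq I) (a b : I -> X)
    (e : I -> bool) :
  perm_eq ([seq if e i then b i else a i | i <- s] ++
           [seq if e i then a i else b i | i <- s])
          ([seq a i | i <- s] ++ [seq b i | i <- s]).
Proof.
apply/permP => P; rewrite !count_cat !count_map.
elim: s => //= i s ih; case: (e i) => /=; lia.
Qed.

Lemma half_double (R : numFieldType) (V : lmodType R) (x : V) :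
  2^-1 *: (x + x) = x.
Proof. by rewrite -mulr2n -(scaler_nat 2 x) scalerA mulVf ?pnatr_eq0// scale1r. Qed.

(** The point taken from the pair [a j i], [b j i] differs from half the sum of the pair by half of
    their difference, up to sign. The deviation is thus half a signed sum of [r * m] vectors of norm
    at most [D]. *)
Lemma halve_even (R : realType) (X : normedModType R) (p T D : R) (r m : nat)
    (z : 'I_r -> seq X) : 0 < p -> 0 <= T -> type_constant X p T -> 0 <= D ->
  (forall j, size (z j) = (m + m)%N) ->
  (forall j, {in z j &, forall x y, `|x - y| <= D}) ->
  exists q q' : 'I_r -> seq X,
    [/\ forall j, perm_eq (q j ++ q' j) (z j), forall j, size (q j) = m &
      `| \sum_j \sum_(x <- q j) x - 2^-1 *: \sum_j \sum_(x <- z j) x |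
      <= 2^-1 * (T * (r * m)%:R `^ p^-1 * D)].
Proof.
move=> p0 T0 hT D0 sz zD.
pose a j (i : 'I_m) := nth 0 (z j) i; pose b j (i : 'I_m) := nth 0 (z j) (m + i).
have abD (u : 'I_r * 'I_m) : `|a u.1 u.2 - b u.1 u.2| <= D.
  by apply: zD; apply: mem_nth; rewrite sz; have := ltn_ord u.2; lia.
have [e] := type_sign p0 T0 hT D0 abD.
rewrite card_prod !card_ord => he.
have zE j : z j = [seq a j i | i <- enum 'I_m] ++ [seq b j i | i <- enum 'I_m].
  have szm (f : 'I_m -> X) : size [seq f i | i <- enum 'I_m] = m.
    by rewrite size_map size_enum_ord.
  have nthm (f : 'I_m -> X) i (im : (i < m)%N) :
      nth 0 [seq f i | i <- enum 'I_m] i = f (Ordinal im).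
    rewrite (nth_map (Ordinal im)) ?size_enum_ord//.
    by congr f; apply: val_inj; rewrite /= nth_enum_ord.
  apply: (@eq_from_nth _ 0) => [|i]; rewrite ?size_cat ?szm sz// => ilt.
  rewrite nth_cat szm; case: ltnP => im; first by rewrite nthm.
  have im' : (i - m < m)%N by rewrite ltn_subLR.
  by rewrite nthm /b /= subnKC.
exists (fun j => [seq if e (j, i) then b j i else a j i | i <- enum 'I_m]).
exists (fun j => [seq if e (j, i) then a j i else b j i | i <- enum 'I_m]).
split=> [j|j|].
- by rewrite zE perm_swap_pairs.
- by rewrite size_map size_enum_ord.
- rewrite [X in `|X|](_ : _ = 2^-1 *: \sum_u (-1) ^+ e u *: (a u.1 u.2 - b u.1 u.2)).
    by rewrite normrZ gtr0_norm ?invr_gt0// ler_wpM2l ?invr_ge0.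
  have -> : \sum_u (-1) ^+ e u *: (a u.1 u.2 - b u.1 u.2) =
      \sum_j \sum_i (-1) ^+ e (j, i) *: (a j i - b j i).
    by rewrite pair_bigA; apply: eq_bigr => -[].
  have sumE (f : 'I_m -> X) : \sum_(x <- [seq f i | i <- enum 'I_m]) x = \sum_i f i.
    by rewrite big_map big_enum.
  (* After half of the total is added to both sides, the identity can be checked pair by pair. *)
  apply: (addIr (2^-1 *: \sum_j \sum_(x <- z j) x)).
  rewrite subrK -scalerDr -big_split scaler_sumr; apply: eq_bigr => j _.
  rewrite zE big_cat /= !sumE -!big_split scaler_sumr /=.
  apply: eq_bigr => i _; case: (e (j, i)).
    by rewrite expr1 scaleN1r opprB [a j i + _]addrC addrACA addNr addr0 half_double.
  by rewrite scale1r addrACA addNr addr0 half_double.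
Qed.

(** The bound holds on average over all choice functions [f]. The number of points times the
    deviation of [f] is a sum over [t] of sums of differences [d t j (f j)], and for each [t] the
    norm of the inner sum is at most [L] on average over [f]. *)
Lemma near_mean_choice (R : realType) (X : normedModType R) (p T D : R)
    (r n : nat) (z : 'I_r -> seq X) :
  0 < p -> 0 <= T -> type_constant X p T -> 0 <= D -> (0 < n)%N ->
  (forall j, size (z j) = n) ->
  (forall j, {in z j &, forall x y, `|x - y| <= D}) ->
  exists2 x : 'I_r -> X, forall j, x j \in z j &
    `| \sum_j x j - n%:R^-1 *: \sum_j \sum_(y <- z j) y |
    <= T * r%:R `^ p^-1 * D.
Proof.
move=> p0 T0 hT D0; case: n => // n _ sz zD.
set L := T * _ * D; pose a j (i : 'I_n.+1) := nth 0 (z j) i.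
have az j i : a j i \in z j by rewrite mem_nth// sz.
have sumE j : \sum_(y <- z j) y = \sum_i a j i.
  by rewrite (big_nth 0) sz big_mkord.
(* Here [t - i] is taken modulo [n.+1]: for fixed [i] it runs over all indices as [t] does. *)
pose d t j i := a j i - a j (t - i).
(* The reflection i |-> t - i changes the sign of d t j, so that signs may be
   inserted in the sum over all choices f. *)
have dN t j i : d t j (t - i) = - d t j i by rewrite /d subKr opprB.
have dD t j i : `|d t j i| <= D by exact: zD.
have [N N0 [e he]] := type_average 'I_r p0 T0 hT; rewrite card_ord -/L in he.
pose F := {ffun 'I_r -> 'I_n.+1}.
have refl t (s : 'I_N) : \sum_(f : F) `|\sum_j d t j (f j)| =
    \sum_(f : F) `|\sum_j (-1) ^+ e s j *: d t j (f j)|.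
  pose h (f : F) : F := [ffun j => if e s j then t - f j else f j].
  have hK : involutive h.
    by move=> f; apply/ffunP => j; rewrite !ffunE; case: (e s j); rewrite ?subKr.
  rewrite (reindex_inj (inv_inj hK)); apply: eq_bigr => f _; congr (`|_|).
  apply: eq_bigr => j _; rewrite ffunE; case: (e s j); rewrite ?scale1r//.
  by rewrite dN expr1 scaleN1r.
have sumd t : \sum_(f : F) `|\sum_j d t j (f j)| <= #|F|%:R * L.
  (* By [refl] the sum over [f] is the same for all [N] sign patterns; after exchanging the sums,
     [he] applies to each [f]. *)
  rewrite -(@ler_pM2l _ N%:R) ?ltr0n// mulr_natl -[X in _ *+ X]card_ord -sumr_const.
  under eq_bigr => s _ do rewrite (refl t s).
  rewrite exchange_big mulrCA mulr_natl -sumr_const.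
  by apply: ler_sum => f _; apply: he.
pose g (f : F) := `|\sum_j a j (f j) - n.+1%:R^-1 *: \sum_j \sum_i a j i|.
have n0 : (0 : R) < n.+1%:R by rewrite ltr0n.
have gd (f : F) : n.+1%:R * g f <= \sum_t `|\sum_j d t j (f j)|.
  rewrite -[X in X * _](gtr0_norm n0) -normrZ scalerBr scalerA divff ?gt_eqF//.
  rewrite scale1r (_ : _ - _ = \sum_t \sum_j d t j (f j)) ?ler_norm_sum//.
  rewrite [RHS]exchange_big /= scaler_sumr -sumrB; apply: eq_bigr => j _.
  rewrite sumrB sumr_const card_ord scaler_nat; congr (_ - _).
  by rewrite (reindex_inj (addIr (- f j))).
have [||f fL] := @exists_le_average R F g L.
  by apply/card_gt0P; exists [ffun=> 0].
  rewrite -(ler_pM2l n0) mulr_sumr (le_trans (ler_sum _ (fun f _ => gd f)))//.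
  rewrite exchange_big /= (le_trans (ler_sum _ (fun t _ => sumd t)))//.
  by rewrite sumr_const card_ord -[leLHS]mulr_natl.
exists (fun j => a j (f j)) => //.
by rewrite (eq_bigr _ (fun j _ => sumE j)).
Qed.

Lemma halve (R : realType) (X : normedModType R) (p T D : R) (r n : nat)
    (z : 'I_r -> seq X) : 0 < p -> 0 <= T -> type_constant X p T -> 0 <= D ->
  (1 < n)%N -> (forall j, size (z j) = n) ->
  (forall j, {in z j &, forall x y, `|x - y| <= D}) ->
  exists q q' : 'I_r -> seq X,
    [/\ forall j, perm_eq (q j ++ q' j) (z j), forall j, size (q j) = n./2 &
      `| \sum_j \sum_(x <- q j) x -
         ((n./2)%:R / n%:R) *: \sum_j \sum_(x <- z j) x |
      <= (n./2)%:R `^ p^-1 * (T * r%:R `^ p^-1 * D)].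
Proof.
move=> p0 T0 hT D0 n1 sz zD; set m := n./2; set L := T * _ * D.
have L0 : 0 <= L by rewrite !mulr_ge0// powR_ge0.
have nE := odd_double_half n; rewrite -/m -addnn in nE.
have m1 : 1 <= m%:R `^ p^-1 :> R.
  rewrite -[leLHS](powRr0 m%:R) ler_powR ?invr_ge0 ?(ltW p0)// ler1n.
  by rewrite /m half_gt0.
have LE : T * (r * m)%:R `^ p^-1 * D = m%:R `^ p^-1 * L.
  by rewrite natrM powRM// /L; ring.
have [x0 xz xL] : exists2 x : 'I_r -> X, forall j, x j \in z j &
    `| \sum_j x j - n%:R^-1 *: \sum_j \sum_(y <- z j) y | <= L.
  exact: (near_mean_choice p0 T0 hT D0 (ltnW n1)) sz zD.
have [nodd|neven] := boolP (odd n); last first.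
  rewrite (negbTE neven) add0n in nE.
  have szm j : size (z j) = (m + m)%N by rewrite nE.
  have [q [q' [qz qm qL]]] := halve_even p0 T0 hT D0 szm zD.
  exists q, q'; split => //; rewrite -{1}nE natrD -mulr2n -(mulr_natl _ 2) invfM.
  rewrite mulrCA mulfV ?mulr1 ?pnatr_eq0; last by lia.
  apply: le_trans qL _; rewrite LE.
  have : 0 <= m%:R `^ p^-1 * L by exact: mulr_ge0 (powR_ge0 _ _) _.
  lra.
rewrite nodd /= in nE.
pose y j := rem (x0 j) (z j).
have zy j : perm_eq (z j) (x0 j :: y j) by exact: perm_to_rem.
have szy j : size (y j) = (m + m)%N.
  by rewrite size_rem// sz -nE.
have yD j : {in y j &, forall x y, `|x - y| <= D}.
  by move=> u v /mem_rem uz /mem_rem vz; exact: (zD j).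
have [q [q' [qy qm qL]]] := halve_even p0 T0 hT D0 szy yD.
exists q, (fun j => x0 j :: q' j); split => // [j|].
  by rewrite -cat1s perm_catCA perm_sym (permPl (zy j)) /= perm_cons perm_sym.
have sumzE : \sum_j \sum_(x <- z j) x = \sum_j x0 j + \sum_j \sum_(x <- y j) x.
  rewrite -big_split; apply: eq_bigr => j _ /=.
  by rewrite (perm_big _ (zy j)) big_cons.
move: qL xL; rewrite sumzE LE.
set Q := \sum_j \sum_(x <- q j) x; set Y := \sum_j \sum_(x <- y j) x.
set x := \sum_j x0 j => qL xL.
have -> : Q - (m%:R / n%:R) *: (x + Y) =
    (Q - 2^-1 *: Y) - 2^-1 *: (x - n%:R^-1 *: (x + Y)).
  (* This is where [n = 2m + 1] enters. *)
  have -> : m%:R / n%:R = 2^-1 - 2^-1 * n%:R^-1 :> R.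
    have nR : n%:R = 1 + m%:R + m%:R :> R by rewrite -nE !natrD addrA.
    have n0 : n%:R != 0 :> R by rewrite pnatr_eq0; lia.
    by apply: (mulIf n0); rewrite mulrBl divfK// -mulrA mulVf// nR; field.
  rewrite scalerBl [2^-1 *: (x - _)]scalerBr scalerA scalerDr.
  by rewrite [2^-1 *: x + _]addrC -addrA opprD addrA.
rewrite (le_trans (ler_normB _ _))// normrZ gtr0_norm ?invr_gt0//.
have : L <= m%:R `^ p^-1 * L by rewrite ler_peMl.
lra.
Qed.

(** * The total cost of the halvings *)

Lemma le0_ler_powR (R : realType) (w x y : R) :
  w <= 0 -> 0 < x -> x <= y -> y `^ w <= x `^ w.
Proof.
move=> w0 x0 xy; have y0 : 0 < y by exact: lt_le_trans xy.
rewrite -[w]opprK (powRN x) (powRN y) lef_pV2 ?posrE ?powR_gt0//.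
by rewrite ge0_ler_powR ?nnegrE ?oppr_ge0 ?(ltW x0) ?(ltW y0).
Qed.

(* An upper bound on [\sum_i (n / 2^i) `^ w] with the quotients rounded up,
   in the closed form that makes the induction step elementary. *)
Definition halving_cost (R : realType) (w : R) (n : nat) : R :=
  if (n <= 1)%N then 0 else 1 + (1 - (n.-1)%:R `^ w) / (1 - 2 `^ w).

Lemma powR2_lt1 (R : realType) (w : R) : w < 0 -> 2 `^ w < 1.
Proof.
by move=> w0; rewrite /powR pnatr_eq0 /= expR_lt1 nmulr_rlt0// ln_gt0// ltr1n.
Qed.

Lemma halving_cost_step (R : realType) (w : R) (m n : nat) :
  w < 0 -> (0 < m)%N -> (1 < n)%N -> (m.*2 <= n.+1)%N ->
  m%:R `^ w + halving_cost w m <= halving_cost w n.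
Proof.
move=> w0 m0 n1 mn; have u1 := powR2_lt1 w0.
have u1' : 0 < 1 - 2 `^ w :> R by rewrite subr_gt0.
rewrite /halving_cost [(n <= 1)%N]leqNgt n1 /=.
case: leqP => m1.
  have -> : m = 1%N by lia.
  rewrite powR1 addr0 lerDl divr_ge0 ?(ltW u1')// subr_ge0.
  suff : n.-1%:R `^ w <= 1 `^ w :> R by rewrite powR1.
  by apply: le0_ler_powR; rewrite ?(ltW w0) ?ler1n//; lia.
have ba : m%:R `^ w <= m.-1%:R `^ w :> R.
  by apply: le0_ler_powR; rewrite ?(ltW w0) ?ltr0n ?ler_nat//; lia.
have ca : n.-1%:R `^ w <= 2 `^ w * m.-1%:R `^ w :> R.
  rewrite -powRM ?ler0n// -natrM.
  by apply: le0_ler_powR; rewrite ?(ltW w0) ?ltr0n ?ler_nat//; lia.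
rewrite addrCA lerD2l -lerBrDr -mulrBl ler_pdivlMr//.
have : m%:R `^ w * (1 - 2 `^ w) <= m.-1%:R `^ w * (1 - 2 `^ w).
  by rewrite ler_wpM2r ?(ltW u1').
lra.
Qed.

Lemma halving_cost_le (R : realType) (p : R) (n : nat) (w := (1 - p) / p) :
  1 < p -> p <= 2 -> halving_cost w n <= 2 `^ (1 / p) / (1 - 2 `^ w).
Proof.
move=> p1 p2; have p0 : 0 < p by lra.
have w0 : w < 0 by rewrite /w pmulr_llt0 ?invr_gt0//; lra.
have u1 := powR2_lt1 w0; have u0 := powR_gt0 w (ltr0Sn R 1).
have u1' : 0 < 1 - 2 `^ w :> R by rewrite subr_gt0.
have -> : 1 / p = 1 + w by rewrite /w; field; lra.
rewrite powRD ?pnatr_eq0 ?implybT// powRr1//.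
have u2 : 2^-1 <= 2 `^ w * 2 `^ w :> R.
  rewrite -powRD ?pnatr_eq0 ?implybT// -[leLHS]powR_inv1// ler_powR ?ler1n//.
  rewrite -mulrDl ler_pdivlMr//; lra.
have u3 : 2 / 3 <= 2 `^ w :> R by nra.
rewrite /halving_cost; case: ifP => _; first by rewrite divr_ge0// ltW// mulr_gt0.
rewrite -lerBrDl ler_pdivrMr// mulrBl divfK ?gt_eqF//.
have := powR_ge0 (n.-1%:R : R) w; lra.
Qed.

(** * Iterating the halving down to transversals *)

Lemma half_bounds (n : nat) (m := n./2) : (1 < n)%N ->
  [/\ (0 < m)%N, (m < n)%N, (0 < n - m)%N, (m <= n - m)%N & ((n - m).*2 <= n.+1)%N].
Proof. by rewrite /m => n1; split; lia. Qed.

(** Each [z' j] reorders [z j] so that the [i]-th entries form the [i]-th transversal. Strong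
    induction on [n]: both halves are matched recursively and concatenated. Sums over [j] are
    compared with the sum of the means; division by [r] comes later. *)
Lemma balanced_matching (R : realType) (X : normedModType R) (p T D : R)
    (r n : nat) (z : 'I_r -> seq X) :
  1 < p -> 0 <= T -> type_constant X p T -> 0 <= D -> (0 < n)%N ->
  (forall j, size (z j) = n) ->
  (forall j, {in z j &, forall x y, `|x - y| <= D}) ->
  exists2 z' : 'I_r -> seq X, forall j, perm_eq (z' j) (z j) &
    forall i, (i < n)%N ->
    `| \sum_j nth 0 (z' j) i - n%:R^-1 *: \sum_j \sum_(x <- z j) x |
    <= halving_cost ((1 - p) / p) n * (T * r%:R `^ p^-1 * D).
Proof.
move=> p1 T0 hT D0; set w := (1 - p) / p; set L := T * _ * D.
have p0 : 0 < p by exact: lt_trans p1.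
have w0 : w < 0 by rewrite /w pmulr_llt0 ?invr_gt0//; lra.
have L0 : 0 <= L by rewrite !mulr_ge0// powR_ge0.
have wE k : (0 < k)%N -> k%:R^-1 * k%:R `^ p^-1 = k%:R `^ w :> R.
  move=> k0; rewrite -[X in X * _]powR_inv1// -powRD; last first.
    by rewrite pnatr_eq0 -lt0n k0 implybT.
  by congr (_ `^ _); rewrite /w; field; lra.
elim/ltn_ind: n z => n ih z n0 sz zD.
have [n1|n1] := leqP n 1.
  have {n0}n1 : n = 1%N by lia.
  exists z => // i; rewrite {1}n1 ltnS leqn0 => /eqP ->.
  rewrite [X in `|X|](_ : _ = 0) ?normr0.
    by rewrite /halving_cost n1 /= mul0r.
  rewrite n1 invr1 scale1r -sumrB big1// => j _.
  move: (sz j); rewrite n1; case: (z j) => [|x []]//= _.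
  by rewrite big_seq1 subrr.
have [q [q' [qz qm qL]]] := halve p0 T0 hT D0 n1 sz zD.
rewrite -/L in qL; set m := n./2 in qm qL.
have [m0 mn m'0 mm' m'n1] := half_bounds n1; rewrite -/m in m0 mn m'0 mm' m'n1.
have m'n : (n - m < n)%N by rewrite ltn_subrL m0 ltnW.
have mn1 : (m.*2 <= n.+1)%N by apply: leq_trans m'n1; rewrite leq_double.
set m' := (n - m)%N in m'0 mm' m'n1 m'n.
have q'm j : size (q' j) = m'.
  by rewrite /m' -(sz j) -(perm_size (qz j)) size_cat qm addKn.
have qD j : {in q j &, forall x y, `|x - y| <= D}.
  by move=> x y xq yq; apply: (zD j); rewrite -(perm_mem (qz j)) mem_cat ?xq ?yq.
have q'D j : {in q' j &, forall x y, `|x - y| <= D}.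
  move=> x y xq yq; apply: (zD j); rewrite -(perm_mem (qz j)) mem_cat ?xq ?yq//;
  by rewrite orbT.
have [y yq yL] := ih m mn q m0 qm qD.
have [y' yq' yL'] := ih m' m'n q' m'0 q'm q'D.
have szy j : size (y j) = m by rewrite (perm_size (yq j)).
set Z := \sum_j \sum_(x <- z j) x in qL *.
set Q := \sum_j \sum_(x <- q j) x in qL yL.
(* The deviations of the two halves are opposite, so the bound for the smaller half passes to the
   larger one. *)
have qL' : `|\sum_j \sum_(x <- q' j) x - (m'%:R / n%:R) *: Z|
    <= m'%:R `^ p^-1 * L.
  have Q'E : \sum_j \sum_(x <- q' j) x = Z - Q.
    apply: (addIr Q); rewrite subrK addrC /Z -big_split; apply: eq_bigr => j _.
    by rewrite -(perm_big _ (qz j)) big_cat.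
  have mE : m'%:R / n%:R = 1 - m%:R / n%:R :> R.
    by rewrite /m' natrB ?(ltnW mn)// mulrBl divff// pnatr_eq0 -lt0n.
  rewrite Q'E mE scalerBl scale1r opprB addrC addrA subrK -normrN opprB.
  apply: le_trans qL _; rewrite ler_wpM2r// ge0_ler_powR ?nnegrE ?invr_ge0 ?(ltW p0)//.
  by rewrite ler_nat.
have merge k (u Y : X) : (0 < k)%N ->  (k.*2 <= n.+1)%N ->
    `|Y - (k%:R / n%:R) *: Z| <= k%:R `^ p^-1 * L ->
    `|u - k%:R^-1 *: Y| <= halving_cost w k * L ->
    `|u - n%:R^-1 *: Z| <= halving_cost w n * L.
  move=> k0 kn hY hu.
  have -> : u - n%:R^-1 *: Z =
      (u - k%:R^-1 *: Y) + k%:R^-1 *: (Y - (k%:R / n%:R) *: Z).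
    rewrite scalerBr scalerA mulKf ?pnatr_eq0 -?lt0n// addrA subrK//.
  rewrite (le_trans (ler_normD _ _))// addrC.
  apply: (@le_trans _ _ ((k%:R `^ w + halving_cost w k) * L)).
    rewrite mulrDl lerD// normrZ gtr0_norm ?invr_gt0 ?ltr0n//.
    by rewrite -(wE k k0) -mulrA ler_wpM2l// invr_ge0.
  by rewrite ler_wpM2r// halving_cost_step.
exists (fun j => y j ++ y' j) => [j|i ilt].
  by rewrite (perm_trans _ (qz j))// perm_cat.
have -> : \sum_j nth 0 (y j ++ y' j) i =
    if (i < m)%N then \sum_j nth 0 (y j) i else \sum_j nth 0 (y' j) (i - m).
  by case: ifP => im; apply: eq_bigr => j _; rewrite nth_cat szy im.
case: ltnP => im.
  exact: merge m0 mn1 qL (yL i im).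
have im' : (i - m < m')%N by rewrite ltn_sub2r.
exact: merge m'0 m'n1 qL' (yL' _ im').
Qed.

(** * Convex hulls, distances and diameters *)

(** Induction: the mean of [N] points combines one of them, with weight [N^-1], and the mean of the
    others. *)
Lemma convex_set_mean (R : realType) (V : lmodType R)
    (A : set (convex_lmodType V)) (x : V) (s : seq V) : convex_set A ->
  A x -> (forall y, y \in s -> A y) ->
  A ((size s).+1%:R^-1 *: (x + \sum_(y <- s) y)).
Proof.
move=> cA; elim: s x => [|y s ih] x Ax As.
  by rewrite big_nil addr0 invr1 scale1r.
have Am : A ((size s).+1%:R^-1 *: (y + \sum_(z <- s) z)).
  apply: ih => [|z zs]; first by apply: As; rewrite mem_head.
  by apply: As; rewrite in_cons zs orbT.
set N := (size (y :: s)).+1.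
have N0 : (0 : R) < N%:R by rewrite ltr0n.
have l1 : N%:R^-1 <= 1 :> R by rewrite invf_le1// ler1n.
have l0 : 0 <= N%:R^-1 :> R by rewrite invr_ge0 ltW.
have := cA x _ (Itv01 l0 l1) (mem_set Ax) (mem_set Am); move/set_mem.
rewrite /conv /= scalerA big_cons [in X in _ -> X]scalerDr.
have -> // : (1 - N%:R^-1) * (size s).+1%:R^-1 = N%:R^-1 :> R.
have NN0 : N%:R != 0 :> R by rewrite gt_eqF.
apply: (mulfI NN0); rewrite mulrA mulrBr mulr1.
rewrite divff ?gt_eqF// /N -natr1 addrK divff//.
by rewrite pnatr_eq0.
Qed.

Lemma conv_hull_mean (R : realType) (X : normedModType R) (A : set X) (n : nat)
    (x : 'I_n -> X) : (0 < n)%N -> (forall i, A (x i)) ->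
  conv_hull A (n%:R^-1 *: \sum_i x i).
Proof.
case: n x => // n x _ Ax; rewrite /conv_hull /smallest /= => C [cC AC].
rewrite big_ord_recl /=.
have := @convex_set_mean R X C (x ord0) [seq x (lift ord0 i) | i <- enum 'I_n] cC.
rewrite size_map size_enum_ord big_map big_enum; apply; first exact/AC/Ax.
by move=> _ /mapP[i _ ->]; exact/AC/Ax.
Qed.

Lemma edist_inf_le (R : realType) (X : normedModType R) (A : set X) (q a : X)
    (B : R) : A a -> `|q - a| <= B -> (edist_inf A q <= B%:E)%E.
Proof.
move=> Aa qaB; have B0 : 0 <= B by exact: le_trans qaB.
apply: (@le_trans _ _ (edist (q, a))).
  by apply: ereal_inf_lbound; exists a.
(* The balls are open, so the radius [B + e] is used for every [e > 0]. *)
apply/lee_addgt0Pr => e e0; rewrite -EFinD; apply: edist_fin => /=.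
  by rewrite ltr_wpDl.
by rewrite -ball_normE /= (le_lt_trans qaB)// ltrDl.
Qed.

Lemma card_eq_seq (T : pointedType) (A : set T) (n : nat) : (A #= `I_n)%card ->
  exists s : seq T, [/\ uniq s, size s = n & forall x, A x <-> x \in s].
Proof.
rewrite card_eq_sym => /card_set_bijP[f [fA finj fsurj]].
exists [seq f i | i <- iota 0 n]; split.
- rewrite map_inj_in_uniq ?iota_uniq// => i j.
  by rewrite !mem_iota !add0n /= => iN jN; apply: finj; rewrite inE.
- by rewrite size_map size_iota.
- move=> x; split.
    by move=> /fsurj[i /= iN <-]; apply: map_f; rewrite mem_iota.
  by move=> /mapP[i]; rewrite mem_iota add0n /= => iN ->; apply: fA.
Qed.

(** A real [sup] bounds its elements only if the set is bounded; the enumeration [s] supplies a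
    maximum over pairs. *)
Lemma le_diam (R : realType) (X : normedModType R) (A : set X) (s : seq X) x y :
  (forall x, A x <-> x \in s) -> A x -> A y -> `|x - y| <= diam A.
Proof.
move=> As Ax Ay; apply: ub_le_sup; last by exists x, y.
exists (\big[Num.max/0]_(u <- [seq (u, v) | u <- s, v <- s]) `|u.1 - u.2|).
move=> _ [u [v [/As us /As vs ->]]].
by apply: (le_bigmax_seq _ (u, v)) => //; exact: allpairs_f.
Qed.

(** * The partition into transversals *)

(** For a single vector the inequality bounds a nonnegative sum by [2 * T * |x|]; a negative [T]
    forces [x = 0]. *)
Lemma type_constant_ge0 (R : realType) (X : normedModType R) (p T : R) :
  0 < p -> type_constant X p T -> 0 <= T \/ forall x : X, x = 0.
Proof.
move=> p0 hT; have [T0|T0] := leP 0 T; [by left|right=> x].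
have := type_constant_dyadic (fun _ : 'I_1 => x) hT.
rewrite [in X in _ <= X]big_ord1 -powRrM divff ?gt_eqF// powRr1//.
move=> /(le_trans (sumr_ge0 _ (fun _ _ => normr_ge0 _))).
rewrite pmulr_rge0 ?ltr0n ?expn_gt0// nmulr_rge0// normr_le0.
by move/eqP.
Qed.

Lemma invr_mul_powR (R : realType) (p x : R) : 0 < x -> 0 < p ->
  x^-1 * x `^ p^-1 = x `^ ((1 - p) / p).
Proof.
move=> x0 p0; rewrite -[X in X * _]powR_inv1 ?(ltW x0)// -powRD.
  by congr (_ `^ _); field; rewrite gt_eqF.
by rewrite (gt_eqF x0) implybT.
Qed.

Lemma balanced_partition (R : realType) (X : normedModType R) (p T D : R)
    (r k : nat) (Z : 'I_r -> set X) (w := (1 - p) / p) :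
  1 < p -> p <= 2 -> 0 <= T -> type_constant X p T -> (0 < r)%N -> (0 < k)%N ->
  trivIset [set: 'I_r] Z -> (forall j, (Z j #= `I_k)%card) -> 0 <= D ->
  (forall j x y, Z j x -> Z j y -> `|x - y| <= D) ->
  exists (q : X) (S : 'I_k -> set X),
    [/\ \bigcup_(i in [set: 'I_k]) S i = \bigcup_(j in [set: 'I_r]) Z j,
        trivIset [set: 'I_k] S,
        forall (i : 'I_k) (j : 'I_r), (S i `&` Z j #= `I_1)%card &
        forall i, (edist_inf (conv_hull (S i)) q
          <= (2 `^ (1 / p) / (1 - 2 `^ w) * T * r%:R `^ w * D)%:E)%E].
Proof.
move=> p1 p2 T0 hT r0 k0 tZ cZ D0 ZD; have p0 : 0 < p by exact: lt_trans p1.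
have /choice[z zP] := fun j => card_eq_seq (cZ j).
have zZ j x : Z j x <-> x \in z j by have [_ _] := zP j.
have sz j : size (z j) = k by have [] := zP j.
have zD j : {in z j &, forall x y, `|x - y| <= D}.
  by move=> x y /zZ xZ /zZ yZ; exact: ZD xZ yZ.
have [y yz hy] := balanced_matching p1 T0 hT D0 k0 sz zD.
have sy j : size (y j) = k by rewrite (perm_size (yz j)).
have yu j : uniq (y j) by rewrite (perm_uniq (yz j)); have [] := zP j.
have yZ j x : Z j x <-> x \in y j by rewrite (perm_mem (yz j)).
have ynZ j (i : 'I_k) : Z j (nth 0 (y j) i) by apply/yZ/mem_nth; rewrite sy.
have Z_inj j j' x : Z j x -> Z j' x -> j = j'.
  by move=> xj xj'; apply: tZ => //; exists x.
(* The centroid of the union; the extra factor [r%:R^-1] turns [r%:R]^ p^-1[into]r%:R [^ w]. *)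
exists (r%:R^-1 *: (k%:R^-1 *: \sum_j \sum_(x <- z j) x)).
exists (fun i => range (fun j => nth 0 (y j) i)); split.
- apply/seteqP; split => x.
    by move=> [i _ [j _ <-]]; exists j.
  move=> [j _ /yZ xy]; have ix : (index x (y j) < k)%N by rewrite -(sy j) index_mem.
  by exists (Ordinal ix) => //; exists j => //=; rewrite nth_index.
- move=> i i' _ _ [x [[j _ <-] [j' _ e]]].
  have jj : j' = j by apply: Z_inj (ynZ j' i') _; rewrite e.
  rewrite jj in e; apply/val_inj/eqP.
  by rewrite -(@nth_uniq _ 0 (y j)) ?sy ?ltn_ord ?yu ?e.
- move=> i j; rewrite (_ : _ `&` _ = [set nth 0 (y j) i]) ?card_set1//.
  apply/seteqP; split => x /=.
    by move=> [[j' _ <-] xZ]; rewrite (Z_inj _ _ _ (ynZ j' i) xZ).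
  by move=> ->; split => //; exists j.
- move=> i; apply: (@edist_inf_le _ _ _ _ (r%:R^-1 *: \sum_j nth 0 (y j) i)).
    by apply: conv_hull_mean => // j; exists j.
  have rR : 0 < r%:R :> R by rewrite ltr0n.
  rewrite distrC -scalerBr normrZ gtr0_norm ?invr_gt0//.
  rewrite mulrC ler_pdivrMr//; apply: le_trans (hy i (ltn_ord i)) _.
  rewrite /w -(invr_mul_powR rR p0) -/w.
  rewrite [leRHS](_ : _ = 2 `^ (1 / p) / (1 - 2 `^ w) * (T * r%:R `^ p^-1 * D)).
    apply: ler_wpM2r; last exact: halving_cost_le.
    by rewrite !mulr_ge0// powR_ge0.
  by set c := 2 `^ _ / _; field; rewrite gt_eqF.
Qed.

Theorem theorem1 (R : realType) (X : completeNormedModType R) (p T : R)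
    (hp1 : 1 < p) (hp2 : p <= 2) (hT : type_constant X p T)
    (r k : nat) (hr : (0 < r)%N) (hk : (0 < k)%N) (Z : 'I_r -> set X)
    (hdisj : trivIset [set: 'I_r] Z) (hcard : forall i : 'I_r, (Z i #= `I_k)%card) :
  let w : R := (1 - p) / p in
  let C : R := 2 `^ (1 / p) / (1 - 2 `^ w) * T in
  let D : R := \big[Num.max/0]_(i < r) diam (Z i) in
  exists (q : X) (S : 'I_k -> set X),
    [/\ \bigcup_(i in [set: 'I_k]) S i = \bigcup_(j in [set: 'I_r]) Z j,
        trivIset [set: 'I_k] S,
        forall (i : 'I_k) (j : 'I_r), (S i `&` Z j #= `I_1)%card &
        forall i : 'I_k,
          (edist_inf (conv_hull (S i)) q <= (C * r%:R `^ w * D)%:E)%E].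
Proof.
move=> w C D; have p0 : 0 < p by exact: lt_trans hp1.
have D0 : 0 <= D by exact: bigmax_ge_id.
have ZD j x y : Z j x -> Z j y -> `|x - y| <= D.
  move=> xZ yZ; have [s [_ _ sZ]] := card_eq_seq (hcard j).
  exact: le_trans (le_diam sZ xZ yZ) (le_bigmax _ _ j).
have [T0|X0] := type_constant_ge0 p0 hT.
  exact: balanced_partition.
(* In the zero space [D = 0] and 0 is a type constant, so the partition obtained for 0 has the
   required bound, both bounds being 0. *)
have DE : D = 0.
  apply/eqP; rewrite eq_le D0 andbT; apply: bigmax_le => // j _.
  have [[|x s] [_ sk sZ]] := card_eq_seq (hcard j).
    by move: hk; rewrite -sk.
  (* The set of distances must be nonempty here, which comes from [0 < k]. *)
  apply: ge_sup => [|_ [u [v [_ _ ->]]]]; last by rewrite (X0 (u - v)) normr0.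
  by exists `|x - x|, x, x; split => //; apply/sZ; rewrite mem_head.
have hT0 : type_constant X p 0.
  move=> n x; rewrite mul0r integral0_eq// => t _.
  by rewrite [X in `|X|]X0 normr0.
have [q [S [SU St SZ Sq]]] :=
  balanced_partition hp1 hp2 (lexx 0) hT0 hr hk hdisj hcard D0 ZD.
exists q, S; split => // i; apply: le_trans (Sq i) _.
by rewrite DE !mulr0.
Qed.
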